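(* Let $X$ be a Gromov product space whose Gromov product boundary $\partial_PX$ has at least four points. Then the injective hull $E(X)$ of $X$ is isometric to the Moebius space $\mathcal{M}(\partial_PX)$.
   Context: Antipodal spaces and Moebius spaces. Let $Z$ be a compact metrizable space containing at least four points. A separating function on $Z$ is a continuous function $\rho : Z\times Z\to[0,\infty)$ which is symmetric and satisfies $\rho(\xi,\eta)=0$ if and only if $\xi=\eta$. Its cross-ratio is defined on quadruples of distinct points of $Z$ by $[\xi,\xi',\eta,\eta']_\rho=\frac{\rho(\xi,\eta)\rho(\xi',\eta')}{\rho(\xi,\eta')\rho(\xi',\eta)}$. Two separating functions are Moebius equivalent if their cross-ratios agree. If $\rho_1,\rho_2$ are Moebius equivalent, there is a unique positive continuous function $\frac{d\rho_2}{d\rho_1}:Z\to(0,\infty)$, the derivative, such that $\rho_2(\xi,\eta)^2=\frac{d\rho_2}{d\rho_1}(\xi)\frac{d\rho_2}{d\rho_1}(\eta)\rho_1(\xi,\eta)^2$ for all $\xi,\eta\in Z$. An antipodal function on $Z$ is a separating function $\rho$ such that $\sup_{\xi,\eta}\rho(\xi,\eta)=1$ and for every $\xi\in Z$ there is $\eta\in Z$ with $\rho(\xi,\eta)=1$. An antipodal space $(Z,\rho_0)$ is such a space $Z$ equipped with an antipodal function $\rho_0$. Its Moebius space $\mathcal{M}(Z)=\mathcal{M}(Z,\rho_0)$ is the set of all antipodal functions on $Z$ Moebius equivalent to $\rho_0$, with the metric $d_{\mathcal{M}}(\rho_1,\rho_2)=\left\|\log\frac{d\rho_2}{d\rho_1}\right\|_\infty$.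 Gromov product spaces. A metric space is proper if closed balls are compact, and geodesically complete if every geodesic segment extends to a bi-infinite geodesic. $(y|z)_x=\frac12(d(x,y)+d(x,z)-d(y,z))$. A proper, geodesic, geodesically complete metric space $X$ is a Gromov product space if there is a second countable Hausdorff compactification $\widehat X$ of $X$ such that for every $x\in X$ the Gromov product $(\cdot|\cdot)_x:X\times X\to[0,+\infty)$ extends to a continuous function $\widehat X\times\widehat X\to[0,+\infty]$ such that for $\xi,\eta\in\widehat X\setminus X$, $(\xi|\eta)_x=+\infty$ if and only if $\xi=\eta$. Such a compactification is unique up to equivalence; it is denoted $\widehat X^P$, and $\partial_PX:=\widehat X^P\setminus X$ is the Gromov product boundary. For $x\in X$ set $\rho_x=e^{-(\cdot|\cdot)_x}$ on $\partial_PX\times\partial_PX$. When $\partial_PX$ has at least four points, the $\rho_x$ are antipodal functions on $\partial_PX$, all Moebius equivalent; $\partial_PX$ is regarded as an antipodal space with any of them, and $\mathcal{M}(\partial_PX)=\mathcal{M}(\partial_PX,\rho_x)$ does not depend on $x$. Injective hull. A metric space $W$ is injective if every $1$-Lipschitz map $A\to W$ from a subset $A$ of a metric space $B$ extends to a $1$-Lipschitz map $B\to W$. The injective hull $E(X)$ of a metric space $X$ is the smallest injective metric space into which $X$ embeds isometrically (there is an isometric embedding $e:X\to E(X)$ such that every isometric embedding of $X$ into an injective metric space factors through $e$). Concretely (Isbell), let $\Delta(X)$ be the set of functions $f:X\to\mathbb{R}$ with $f(x)+f(y)\ge d(x,y)$ for all $x,y\in X$, partially ordered pointwise; $E(X)$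 is the set of minimal elements of $\Delta(X)$ (extremal functions) with metric $d(f,g)=\|f-g\|_\infty$ (which is finite), and $e(x)=d(x,\cdot)$. *)

(* Defs.v *)
From mathcomp Require Export all_boot all_order all_algebra.
From mathcomp Require Export all_classical all_reals all_analysis.
Export Order.TTheory GRing.Theory Num.Theory.
Export numFieldNormedType.Exports.

Set Implicit Arguments.
Unset Strict Implicit.
Unset Printing Implicit Defensive.

Local Open Scope classical_set_scope.
Local Open Scope ring_scope.

Definition isometric_sets (R : realType) (T U : Type)
    (A : set T) (dA : T -> T -> R) (B : set U) (dB : U -> U -> R) : Prop :=
  exists2 f : T -> U, set_bij A B f &
    forall x y, A x -> A y -> dB (f x) (f y) = dA x y.

Definition sup_norm (R : realType) (T : Type) (f : T -> R) : R :=
  sup (range (fun x => `|f x|)).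

Definition separating (R : realType) (Z : topologicalType)
    (rho : Z -> Z -> R) : Prop :=
  [/\ continuous (fun p : Z * Z => rho p.1 p.2),
      forall xi eta, 0 <= rho xi eta,
      forall xi eta, rho xi eta = rho eta xi
    & forall xi eta, rho xi eta = 0 <-> xi = eta].

Definition cross_ratio (R : realType) (Z : Type) (rho : Z -> Z -> R)
    (xi xi' eta eta' : Z) : R :=
  (rho xi eta * rho xi' eta') / (rho xi eta' * rho xi' eta).

Definition moebius_equivalent (R : realType) (Z : topologicalType)
    (rho1 rho2 : Z -> Z -> R) : Prop :=
  forall xi xi' eta eta', uniq [:: xi; xi'; eta; eta'] ->
    cross_ratio rho1 xi xi' eta eta' = cross_ratio rho2 xi xi' eta eta'.

Definition is_moebius_derivative (R : realType) (Z : topologicalType)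
    (rho1 rho2 : Z -> Z -> R) (f : Z -> R) : Prop :=
  [/\ continuous f, forall xi, 0 < f xi
    & forall xi eta, rho2 xi eta ^+ 2 = f xi * f eta * rho1 xi eta ^+ 2].

(* The derivative d rho2 / d rho1.  It exists and is unique for Moebius
   equivalent separating functions on a compact space with at least four
   points; outside that case the value is irrelevant. *)
Definition moebius_derivative (R : realType) (Z : topologicalType)
    (rho1 rho2 : Z -> Z -> R) : Z -> R :=
  xget (fun=> 1) [set f | is_moebius_derivative rho1 rho2 f].

(* The real-valued [sup] is 0 on unbounded sets, so the second clause also
   says that rho is bounded. *)
Definition antipodal (R : realType) (Z : topologicalType)
    (rho : Z -> Z -> R) : Prop :=
  [/\ separating rho,
      sup (range (fun p : Z * Z => rho p.1 p.2)) = 1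
    & forall xi, exists eta, rho xi eta = 1].

Definition moebius_space (R : realType) (Z : topologicalType)
    (rho0 : Z -> Z -> R) : set (Z -> Z -> R) :=
  [set rho | antipodal rho /\ moebius_equivalent rho0 rho].

Definition moebius_dist (R : realType) (Z : topologicalType)
    (rho1 rho2 : Z -> Z -> R) : R :=
  sup_norm (fun xi => ln (moebius_derivative rho1 rho2 xi)).
Arguments moebius_dist {R} Z rho1 rho2.

Definition proper_metric (R : realType) (X : metricType R) : Prop :=
  forall (x : X) (r : R), compact [set y | mdist x y <= r].

Definition isometric_on (R : realType) (X : metricType R)
    (A : set R) (c : R -> X) : Prop :=
  forall s t, A s -> A t -> mdist (c s) (c t) = `|s - t|.

Definition geodesic_space (R : realType) (X : metricType R) : Prop :=
  forall x y : X, exists c : R -> X,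
    [/\ isometric_on `[0, mdist x y] c, c 0 = x & c (mdist x y) = y].

Definition geodesically_complete (R : realType) (X : metricType R) : Prop :=
  forall (a b : R) (c : R -> X), a < b -> isometric_on `[a, b] c ->
    exists2 l : R -> X, isometric_on setT l & {in `[a, b], l =1 c}.

Definition gromov_product (R : realType) (X : metricType R) (x y z : X) : R :=
  (mdist x y + mdist x z - mdist y z) / 2.

(* A second countable Hausdorff compactification of X, i.e. a dense
   topological embedding into such a compact space, together with the
   continuous extensions of the Gromov products (which are determined by
   density). *)
Record gromov_compactification (R : realType) (X : metricType R) := {
  gc_space : topologicalType ;
  gc_embed : X -> gc_space ;
  gc_prod : X -> gc_space -> gc_space -> \bar R ;
  gc_second_countable : @second_countable gc_space ;
  gc_hausdorff : hausdorff_space gc_space ;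
  gc_compact : compact [set: gc_space] ;
  gc_embed_inj : injective gc_embed ;
  gc_embed_continuous : continuous gc_embed ;
  gc_embed_open : forall U : set X, open U ->
    exists2 V : set gc_space, open V & gc_embed @^-1` V = U ;
  gc_embed_dense : dense (range gc_embed) ;
  gc_prod_continuous : forall x,
    continuous (fun p : gc_space * gc_space => gc_prod x p.1 p.2) ;
  gc_prod_ge0 : forall x xi eta, (0 <= gc_prod x xi eta)%E ;
  gc_prod_embed : forall x y z,
    gc_prod x (gc_embed y) (gc_embed z) = (gromov_product x y z)%:E ;
  gc_prod_eqy : forall x xi eta,
    (~` range gc_embed) xi -> (~` range gc_embed) eta ->
    (gc_prod x xi eta = +oo%E <-> xi = eta) }.

Definition gromov_product_space (R : realType) (X : metricType R) : Prop :=
  [/\ proper_metric X, geodesic_space X, geodesically_complete X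
    & inhabited (gromov_compactification X)].

Definition gromov_boundary (R : realType) (X : metricType R)
    (C : gromov_compactification X) : set (gc_space C) :=
  ~` range (@gc_embed R X C).
Arguments gromov_boundary {R X} C.

(* exp (- (xi | eta)_x), with exp (- oo) = 0. *)
Definition boundary_rho (R : realType) (X : metricType R)
    (C : gromov_compactification X) (x : X)
    (xi eta : gromov_boundary C) : R :=
  fine (expeR (- gc_prod x (set_val xi) (set_val eta))%E).
Arguments boundary_rho {R X} C x xi eta.

Definition Delta (R : realType) (X : metricType R) : set (X -> R) :=
  [set f | forall x y, mdist x y <= f x + f y].

(* Isbell's model: the extremal functions, with the sup metric. *)
Definition injective_hull (R : realType) (X : metricType R) : set (X -> R) :=
  [set f | Delta f /\
    forall g, Delta g -> (forall x, g x <= f x) -> g = f].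
Arguments injective_hull {R} X.

Definition hull_dist (R : realType) (X : metricType R) (f g : X -> R) : R :=
  sup_norm (fun x => f x - g x).
Arguments hull_dist {R} X f g.

(* Main.v *)
Require Import Defs.
From mathcomp Require Import ring lra.
Set Implicit Arguments.
Unset Strict Implicit.
Unset Printing Implicit Defensive.
Local Open Scope classical_set_scope.
Local Open Scope card_scope.
Local Open Scope ring_scope.

(** Both spaces of the theorem are identified with the same space of functions
    on the boundary.  Write [(xi|eta)] for the Gromov product based at [x].  A
    potential is a continuous [tau] on the boundary with
    [tau xi + tau eta <= 2 (xi|eta)], equality being attained for every [xi];
    potentials carry the sup distance.

    Moebius side.  For Moebius equivalent separating functions the ratio
    [q = rho2 / rho1] satisfies [q a c * q b d = q a d * q b c], and this forces
    [q xi eta ^+ 2 = f xi * f eta] for a unique positive continuous [f]: the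
    derivative exists ([moebius_derivative_exists]).  So every element of the
    Moebius space is [exp ((tau xi + tau eta) / 2) * rho_x xi eta] with [tau]
    the logarithm of its derivative, being antipodal means that [tau] is a
    potential, and the Moebius distance is the sup distance of the potentials
    ([potential_isometric_moebius]).

    Hull side.  To a potential [tau] corresponds the function
    [f y = sup_xi (tau xi + b_xi y)], where [b_xi y] is the limit of
    [d (y, w) - d (x, w)] as [w] tends to [xi].
    - [f] lies in [Delta X]: a geodesic from [y] to [z] prolonged beyond [z]
      accumulates at some [eta] with [b_eta y - b_eta z = d (y, z)], and adding
      the contribution of a partner [xi] of [eta] at [z] gives
      [f y + f z >= d (y, z)] ([extremal_of_Delta]).
    - [d (x, w) - f w] tends to [tau xi] as [w] tends to [xi], by compactness
      of the boundary ([extremal_of_near]); hence [f] is minimal and [tau] is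
      recovered isometrically from [f].
    - Conversely, for [f] extremal set [h w = d (x, w) - f w].  It is bounded
      with [h y + h z <= 2 (y|z)]; since [f] is extremal and geodesics can be
      prolonged, for every [y] this is almost an equality for some [z]
      arbitrarily far away.  Passing to the limit, the closure of the graph of
      [h] satisfies the same two properties above the boundary, and they force
      it to be the graph of a function there, which is the required potential
      ([extremal_has_potential]). *)

(** * Isometries, sup norms and closures *)

Lemma isometric_sets_sym (R : realType) (T U : Type)
    (A : set T) (dA : T -> T -> R) (B : set U) (dB : U -> U -> R) :
  U -> T -> isometric_sets A dA B dB -> isometric_sets B dB A dA.
Proof.
move=> u0 t0 [f [fAB finj fsurj] fd].
have /choice [g gP] u : exists t, B u -> A t /\ f t = u.
  by have [/fsurj[t At <-]|nBu] := pselect (B u); [exists t|exists t0].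
exists g; last by move=> u v /gP[Au fu] /gP[Av fv]; rewrite -fd// fu fv.
split.
- by move=> u /gP[].
- move=> u v /set_mem/gP[_ fu] /set_mem/gP[_ fv] guv.
  by rewrite -fu -fv guv.
- move=> t At; exists (f t); first exact: fAB.
  have [Agt fgt] := gP _ (fAB _ At).
  by apply: finj => //; exact/mem_set.
Qed.

Lemma isometric_sets_trans (R : realType) (T U V : Type)
    (A : set T) (dA : T -> T -> R) (B : set U) (dB : U -> U -> R)
    (C : set V) (dC : V -> V -> R) :
  isometric_sets A dA B dB -> isometric_sets B dB C dC ->
  isometric_sets A dA C dC.
Proof.
move=> [f [fAB finj fsurj] fd] [g [gBC ginj gsurj] gd].
exists (g \o f); last by move=> s t As At /=; rewrite gd ?fd//; exact: fAB.
split.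
- by move=> t /fAB/gBC.
- move=> s t sA tA /ginj E; apply: finj => //.
  by apply: E; apply/mem_set/fAB/set_mem.
- by move=> v /gsurj[u /fsurj[t At <-] <-]; exists t.
Qed.

Lemma sup_norm_distC (R : realType) (T : Type) (f g : T -> R) :
  sup_norm (f \- g) = sup_norm (g \- f).
Proof.
rewrite /sup_norm.
have -> // : (fun t => `|(f \- g) t|) = (fun t => `|(g \- f) t|).
by apply/funext => t; rewrite distrC.
Qed.

Section SupNorm.
Context (R : realType) (T : Type).
Implicit Types (f g : T -> R).

Lemma sup_norm_ge f (M : R) t : (forall t, `|f t| <= M) -> `|f t| <= sup_norm f.
Proof.
move=> fM; apply: ub_le_sup; last by exists t.
by exists M => _ [s _ <-]; exact: fM.
Qed.

Lemma sup_norm_le (t0 : T) f (M : R) :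
  (forall t, `|f t| <= M) -> sup_norm f <= M.
Proof.
move=> fM; apply: ge_sup; first by exists `|f t0|, t0.
by move=> _ [s _ <-]; exact: fM.
Qed.

End SupNorm.

(** A map into a compact set has a limit value at every point adherent to the
    parameter set: cluster points stand in for convergent subsequences. *)
Lemma closure_graph (T U : topologicalType) (I : Type) (f : I -> T) (g : I -> U)
    (A : set U) (p : T) : compact A -> (forall i, A (g i)) ->
  closure (range f) p ->
  exists q, closure (range (fun i => (f i, g i))) (p, q).
Proof.
move=> cA Ag clp.
pose F := filter_from (nbhs p) (fun V => f @^-1` V).
have FF : ProperFilter F.
  apply: filter_from_proper.
    apply: filter_from_filter; first by exists setT; exact: filterT.
    by move=> V W Vp Wp; exists (V `&` W) => //; exact: filterI.
  by move=> V /clp [_ [[i _ <-] Vi]]; exists i.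
have [|q [_ clq]] := cA (g @ F) _.
  by exists setT => [|i _]; [exact: filterT|exact: Ag].
exists q => B [[V W] /= [Vp Wq] VW].
have GV : (g @ F) (g @` (f @^-1` V)) by exists V => // i Vi; exists i.
have [_ [[i Vi <-] Wi]] := clq _ _ GV Wq.
by exists (f i, g i); split; [exists i|exact: VW].
Qed.

Lemma closure_le (T : topologicalType) (R : realType) (A : set T) (f : T -> R)
    (c : R) (p : T) : closure A p -> {for p, continuous f} ->
  (forall q, A q -> f q <= c) -> f p <= c.
Proof.
move=> clp cf fc; rewrite leNgt; apply/negP => /(cvgr_gt _ cf)/clp[q [Aq]].
by rewrite /= ltNge fc.
Qed.

(** * Moebius spaces as spaces of potentials *)

Definition rescale (R : realType) (Z : Type) (rho : Z -> Z -> R)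
    (tau : Z -> R) (xi eta : Z) : R :=
  expR ((tau xi + tau eta) / 2) * rho xi eta.

(** The [tau] for which [rescale rho tau] is antipodal.  With
    [rho = exp (- (.|.))] this reads [tau xi + tau eta <= 2 (xi|eta)], with
    equality attained in each variable: up to sign, the extremality condition
    of Isbell for the infinite-valued kernel [- 2 (xi|eta)]. *)
Definition potential (R : realType) (Z : topologicalType) (rho : Z -> Z -> R)
    : set (Z -> R) :=
  [set tau : Z -> R | [/\ continuous tau,
    forall xi eta, rescale rho tau xi eta <= 1
  & forall xi, exists eta, rescale rho tau xi eta = 1]].

Section MoebiusDerivative.
Context (R : realType) (Z : topologicalType).
Implicit Types (rho : Z -> Z -> R) (tau : Z -> R).
Hypothesis three : forall xi : Z, exists eta zeta : Z, uniq [:: xi; eta; zeta].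

Lemma separating_gt0 rho xi eta : separating rho -> xi != eta -> 0 < rho xi eta.
Proof.
case=> _ rho0 _ rhoE ne; rewrite lt_neqAle rho0 andbT eq_sym.
by apply: contra ne => /eqP/rhoE ->.
Qed.

Lemma separatingxx rho xi : separating rho -> rho xi xi = 0.
Proof. by case=> _ _ _ ->. Qed.

Lemma separating_cont1 rho eta : separating rho ->
  continuous (fun xi => rho xi eta).
Proof.
case=> rc _ _ _ xi.
apply: (@continuous_comp Z (Z * Z)%type R (fun xi => (xi, eta))
  (fun p => rho p.1 p.2)).
  by apply: cvg_pair => //; exact: cvg_cst.
exact: rc.
Qed.

(** A product [f a * f b] known for all [a != b] determines [f]: with three
    points, [f a ^+ 2 = (f a * f b) * (f a * f c) / (f b * f c)]. *)
Lemma moebius_derivative_unique rho1 rho2 f g : separating rho1 ->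
  is_moebius_derivative rho1 rho2 f -> is_moebius_derivative rho1 rho2 g ->
  f = g.
Proof.
move=> s1 [_ f0 fE] [_ g0 gE]; apply/funext => xi.
have E a b : a != b -> f a * f b = g a * g b.
  move=> ab; apply: (@mulIf _ (rho1 a b ^+ 2)); last by rewrite -fE -gE.
  by rewrite expf_neq0// gt_eqF// separating_gt0.
have [eta [zeta /=]] := three xi.
rewrite !inE negb_or !andbT => /andP[/andP[n1 n2] n3].
have E1 := E _ _ n1; have E2 := E _ _ n2; have E3 := E _ _ n3.
have : f xi ^+ 2 * (f eta * f zeta) = g xi ^+ 2 * (f eta * f zeta).
  rewrite [in RHS]E3.
  transitivity ((f xi * f eta) * (f xi * f zeta)); first ring.
  by rewrite E1 E2; ring.
move/mulIf; rewrite mulf_neq0 ?gt_eqF// => /(_ isT)/eqP.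
by rewrite eqrXn2 ?ltW// => /eqP.
Qed.

Lemma moebius_derivativeE rho1 rho2 f : separating rho1 ->
  is_moebius_derivative rho1 rho2 f -> moebius_derivative rho1 rho2 = f.
Proof.
move=> s1 fP; apply: (moebius_derivative_unique s1 _ fP).
exact: (xgetPex _ (ex_intro _ f fP)).
Qed.

(** Equality of the cross-ratios says that [q = rho2 / rho1] satisfies
    [q a c * q b d = q a d * q b c].  Then
    [F xi eta zeta = q xi eta * q xi zeta / q eta zeta] does not depend on
    [eta] and [zeta]; its value is the derivative at [xi]. *)
Section Existence.
Variables rho1 rho2 : Z -> Z -> R.
Hypotheses (s1 : separating rho1) (s2 : separating rho2).
Hypothesis r12 : moebius_equivalent rho1 rho2.

Let q xi eta := rho2 xi eta / rho1 xi eta.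

Let q_gt0 xi eta : xi != eta -> 0 < q xi eta.
Proof. by move=> ne; rewrite divr_gt0// separating_gt0. Qed.

Let qC xi eta : q xi eta = q eta xi.
Proof. by case: s1 => _ _ + _; case: s2 => _ _ + _; rewrite /q => -> ->. Qed.

Let q_cross a b c d : uniq [:: a; b; c; d] -> q a c * q b d = q a d * q b c.
Proof.
move=> u; have := r12 u; move: u; rewrite /cross_ratio /q /= !inE !negb_or.
move=> /and3P[/and3P[ab ac ad] /andP[bc bd] _] E.
have p1 := fun a b => @separating_gt0 rho1 a b s1.
have p2 := fun a b => @separating_gt0 rho2 a b s2.
have := p1 _ _ ac; have := p1 _ _ ad; have := p1 _ _ bc; have := p1 _ _ bd.
have := p2 _ _ ac; have := p2 _ _ ad; have := p2 _ _ bc; have := p2 _ _ bd.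
move: E.
move: (rho1 a c) (rho1 a d) (rho1 b c) (rho1 b d) => x1 x2 x3 x4.
move: (rho2 a c) (rho2 a d) (rho2 b c) (rho2 b d) => y1 y2 y3 y4 E.
move=> h1 h2 h3 h4 h5 h6 h7 h8.
have E' : (x1 * x4) * (y2 * y3) = (y1 * y4) * (x2 * x3).
  by apply/eqP; rewrite -eqr_div ?E ?mulf_neq0// gt_eqF.
rewrite !mulf_div; apply/eqP; rewrite eqr_div ?mulf_neq0//;
  try by rewrite gt_eqF.
by rewrite -E' mulrC.
Qed.

Let F xi eta zeta := q xi eta * q xi zeta / q eta zeta.

Let FC xi eta zeta : F xi eta zeta = F xi zeta eta.
Proof. by rewrite /F [q eta zeta]qC [q xi eta * _]mulrC. Qed.

Let F_step xi eta zeta zeta' : uniq [:: xi; eta; zeta] ->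
  uniq [:: xi; eta; zeta'] -> F xi eta zeta = F xi eta zeta'.
Proof.
have [<-//|zz] := eqVneq zeta zeta'.
rewrite /= !inE !negb_or !andbT => /andP[/andP[n1 n2] n3] /andP[/andP[_ n4] n5].
have := @q_cross xi eta zeta zeta'.
rewrite /= !inE !negb_or n1 n2 n3 n4 n5 zz /= => /(_ isT) E.
rewrite /F -[LHS]mulrA -[RHS]mulrA; congr (_ * _); apply/eqP.
by rewrite eqr_div; [exact/eqP| |]; rewrite gt_eqF// q_gt0.
Qed.

(** Two pairs are joined by exchanging one point at a time, through the pair
    [(eta, eta')] when [eta != eta']. *)
Let F_indep xi eta zeta eta' zeta' : uniq [:: xi; eta; zeta] ->
  uniq [:: xi; eta'; zeta'] -> F xi eta zeta = F xi eta' zeta'.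
Proof.
move=> u u'; have [ee|ne] := eqVneq eta eta'.
  by rewrite -{}ee in u' *; exact: F_step.
have u'' : uniq [:: xi; eta; eta'].
  move: u u'; rewrite /= !inE !negb_or !andbT ne andbT.
  by move=> /andP[/andP[-> _] _] /andP[/andP[-> _] _].
rewrite (F_step u u'') FC; apply: F_step => //.
by move: u''; rewrite /= !inE !negb_or !andbT (eq_sym eta') andbC andbA andbC
  -andbA => /and3P[-> -> ->].
Qed.

(** Near a given point the pair used in [F] can be kept fixed, because
    [rho1 xi' z > 0] is an open condition on [xi']; this gives continuity. *)
Lemma moebius_derivative_exists : exists f, is_moebius_derivative rho1 rho2 f.
Proof.
have /choice [f fP] xi : exists v, forall eta zeta, uniq [:: xi; eta; zeta] ->
    v = F xi eta zeta.
  have [eta [zeta u]] := three xi.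
  by exists (F xi eta zeta) => eta' zeta'; exact: F_indep.
exists f; split.
- move=> xi; have [eta [zeta u]] := three xi.
  have [n1 n2 n3] : [/\ xi != eta, xi != zeta & eta != zeta].
    by move: u; rewrite /= !inE !negb_or !andbT => /andP[/andP[-> ->] ->].
  have cF : {for xi, continuous (fun xi' => F xi' eta zeta)}.
    have cq z : xi != z -> {for xi, continuous (fun xi' => q xi' z)}.
      move=> nz; apply: cvgM; first exact: separating_cont1.
      apply: cvgV; last exact: separating_cont1.
      by rewrite gt_eqF// separating_gt0.
    by apply: cvgM; [apply: cvgM; exact: cq|exact: cvg_cst].
  have near_ne z : xi != z -> \forall xi' \near xi, xi' != z.
    move=> nz; have /(_ xi) c1 := @separating_cont1 rho1 z s1.
    have H : \forall xi' \near xi, 0 < rho1 xi' z.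
      exact: (cvgr_gt _ c1) (separating_gt0 s1 nz).
    near=> xi'; suff: 0 < rho1 xi' z.
      by apply: contraTneq => ->; rewrite separatingxx// ltxx.
    by near: xi'.
  rewrite /continuous_at (fP _ _ _ u); apply: cvg_trans cF.
  apply: near_eq_cvg; have := near_ne _ n2; have := near_ne _ n1.
  apply: filterS2 => xi' m1 m2; rewrite -fP//= !inE !negb_or m1 m2.
  by rewrite n3.
- move=> xi; have [eta [zeta u]] := three xi; rewrite (fP _ _ _ u).
  move: u; rewrite /= !inE !negb_or !andbT => /andP[/andP[n1 n2] n3].
  by apply: divr_gt0; [apply: mulr_gt0|]; exact: q_gt0.
- move=> xi eta; have [->|ne] := eqVneq xi eta.
    by rewrite !separatingxx// expr0n mulr0.
  have [zeta u] : exists zeta, uniq [:: xi; eta; zeta].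
    have [a [b]] := three xi; rewrite /= !inE !negb_or !andbT.
    move=> /andP[/andP[n1 n2] n3]; have [ea|na] := eqVneq eta a.
      by exists b; rewrite /= !inE !negb_or ne n2 ea n3.
    by exists a; rewrite /= !inE !negb_or ne n1 na.
  rewrite (fP xi _ _ u) (fP eta xi zeta); last first.
    move: u; rewrite /= !inE !negb_or !andbT eq_sym.
    by move=> /andP[/andP[-> ->] ->].
  have /andP[/andP[_ n2] n3] : (xi != eta) && (xi != zeta) && (eta != zeta).
    by move: u; rewrite /= !inE !negb_or !andbT.
  rewrite /F (qC eta xi).
  have -> : q xi eta * q xi zeta / q eta zeta *
            (q xi eta * q eta zeta / q xi zeta) = q xi eta ^+ 2.
    by field; rewrite !gt_eqF ?q_gt0.
  by rewrite -exprMn /q divfK// gt_eqF// separating_gt0.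
Unshelve. all: by end_near. Qed.

End Existence.

Section Rescale.
Variable rho : Z -> Z -> R.
Hypothesis s : separating rho.

Lemma separating_rescale tau : continuous tau -> separating (rescale rho tau).
Proof.
case: (s) => rc r0 rC rE tc; split.
- move=> p; apply: cvgM; last exact: rc.
  apply: continuous_cvg; first exact: continuous_expR.
  apply: cvgM; last exact: cvg_cst.
  apply: cvgD.
    exact: (continuous_comp (@cvg_fst _ _ _ _ _) (tc _)).
  exact: (continuous_comp (@cvg_snd _ _ _ _ _) (tc _)).
- by move=> xi eta; rewrite mulr_ge0// expR_ge0.
- by move=> xi eta; rewrite /rescale rC [tau xi + _]addrC.
- move=> xi eta; rewrite -rE; split => [/eqP|E].
    by rewrite mulf_eq0 expR_eq0 => /eqP.
  by rewrite /rescale E mulr0.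
Qed.

(** The logarithm of this derivative is [tau' - tau], so the Moebius distance is
    the sup distance of potentials. *)
Lemma rescale_derivative tau tau' : continuous tau -> continuous tau' ->
  moebius_derivative (rescale rho tau) (rescale rho tau') =
  (fun xi => expR (tau' xi - tau xi)).
Proof.
move=> ct ct'; apply: moebius_derivativeE; first exact: separating_rescale.
split=> [xi|xi|xi eta]; last 1 first.
- rewrite /rescale !exprMn -!expRM_natr -expRD [RHS]mulrA -expRD.
  congr (expR _ * _).
  by field.
- apply: continuous_cvg; first exact: continuous_expR.
  by apply: cvgB; [exact: ct'|exact: ct].
- exact: expR_gt0.
Qed.

Lemma rescale_equivalent tau : moebius_equivalent rho (rescale rho tau).
Proof.
move=> a b c d; rewrite /cross_ratio /rescale /= !inE !negb_or.
move=> /and3P[/and3P[ab ac ad] /andP[bc bd] _].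
have p a' b' : a' != b' -> rho a' b' != 0.
  by move=> n; rewrite gt_eqF// separating_gt0.
rewrite mulrACA -expRD [X in _ = _ / X]mulrACA -expRD.
have -> : (tau a + tau d) / 2 + (tau b + tau c) / 2 =
  (tau a + tau c) / 2 + (tau b + tau d) / 2 by ring.
by rewrite -[RHS]mulf_div divff ?mul1r// gt_eqF// expR_gt0.
Qed.

(** The supremum being [1], the range is bounded: the real supremum of an
    unbounded set is [0]. *)
Lemma antipodal_le1 rho' xi eta : antipodal rho' -> rho' xi eta <= 1.
Proof.
case=> _ s1 _; rewrite -s1; apply: ub_le_sup; last by exists (xi, eta).
apply: contrapT => nb; move: s1; rewrite sup_out; last by case.
by move/esym/eqP; rewrite oner_eq0.
Qed.

Lemma rescale_antipodal tau (z0 : Z) :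
  potential rho tau -> antipodal (rescale rho tau).
Proof.
move=> [tc t1 te]; split => //; first exact: separating_rescale.
have [eta E] := te z0.
apply/eqP; rewrite eq_le; apply/andP; split.
  apply: ge_sup; first by exists (rescale rho tau z0 eta), (z0, eta).
  by move=> _ [[a b] _ <-]; exact: t1.
rewrite -E; apply: ub_le_sup; last by exists (z0, eta).
by exists 1 => _ [[a b] _ <-]; exact: t1.
Qed.

Lemma potential_isometric_moebius (z0 : Z) :
  isometric_sets (potential rho) (fun tau tau' => sup_norm (tau \- tau'))
    (moebius_space rho) (moebius_dist Z).
Proof.
have dist tau tau' : continuous tau -> continuous tau' ->
    (fun xi => ln (moebius_derivative (rescale rho tau) (rescale rho tau') xi))
    = tau' \- tau.
  move=> ct ct'; rewrite rescale_derivative//.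
  by apply/funext => xi; rewrite expRK.
exists (rescale rho); last first.
  move=> tau tau' [ct _ _] [ct' _ _]; rewrite /moebius_dist dist//.
  exact: sup_norm_distC.
split.
- move=> tau tauP; split; first exact: rescale_antipodal.
  exact: rescale_equivalent.
- move=> tau tau' /set_mem[ct _ _] /set_mem[ct' _ _] E.
  have D := dist _ _ ct ct'; have D' := dist _ _ ct ct; rewrite -E D' in D.
  apply/funext => xi; have /= := congr1 (@^~ xi) D.
  by rewrite subrr => /esym/eqP; rewrite subr_eq0 => /eqP.
- move=> rho' [ap eqv]; have [s' _ ap1] := ap.
  have [f [fc f0 fE]] := moebius_derivative_exists s s' eqv.
  have rE : rescale rho (@ln R \o f) = rho'.
    apply/funext => xi; apply/funext => eta.
    have r'0 : 0 <= rho' xi eta by case: s'.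
    have r0 : 0 <= rho xi eta by case: (s).
    apply/eqP; rewrite -(@eqrXn2 _ 2) ?mulr_ge0 ?expR_ge0// fE exprMn.
    rewrite -expRM_natr divfK// expRD !lnK//; exact: f0.
  exists (@ln R \o f) => //; split.
  + move=> xi; exact: (continuous_comp (fc xi) (continuous_ln (f0 xi))).
  + move=> xi eta; rewrite -/(rescale rho (@ln R \o f) xi eta) rE.
    exact: antipodal_le1.
  + by move=> xi; have [eta e1] := ap1 xi; exists eta; rewrite -[RHS]e1 -rE.
Qed.

End Rescale.
End MoebiusDerivative.

(** * Extremal functions *)

Section Extremal.
Context (R : realType) (X : metricType R).
Local Notation d := (@mdist R X).
Variable f : X -> R.
Hypothesis fE : injective_hull X f.

(** If no point were an almost partner of [y], lowering [f] at [y] alone by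
    half of [eps] would give a smaller element of [Delta X]. *)
Lemma extremal_partner y (eps : R) : 0 < eps ->
  exists z, f y + f z <= d y z + eps.
Proof.
move=> eps0; apply: contrapT => nE.
have gt z : d y z + eps < f y + f z.
  by rewrite ltNge; apply/negP => h; apply: nE; exists z.
have [fD fmin] := fE.
(* Half of [eps] keeps the inequality also for the pair [(y, y)]. *)
pose g z := if z == y then f y - eps / 2 else f z.
have gD : Delta g.
  move=> u v; rewrite /g; have := fD u v; have := gt u; have := gt v.
  have [->|_] := eqVneq u y; have [->|_] := eqVneq v y;
    rewrite ?mdistxx ?(metric_sym u); lra.
have gf z : g z <= f z by rewrite /g; case: eqVneq => [->|//]; lra.
have := congr1 (@^~ y) (fmin _ gD gf); rewrite /g eqxx; lra.
Qed.

Lemma extremal_lipschitz y z : f y <= f z + d y z.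
Proof.
apply/ler_addgt0Pr => eps /(extremal_partner y)[w h].
have [/(_ z w) D _] := fE; have := metric_triangle y z w; lra.
Qed.

End Extremal.

(** * Gromov products and Busemann functions on the compactification *)

Section Compactification.
Context (R : realType) (X : metricType R) (C : gromov_compactification X).
Local Notation K := (gc_space C).
Local Notation e := (@gc_embed R X C).
Local Notation d := (@mdist R X).
Local Notation Z := (gromov_boundary C).

(** Density of the space, in the form used for all limits [w --> p] below:
    what holds at the points [w] of the space close to [p] holds somewhere. *)
Lemma near_embed_ex (p : K) (P : X -> Prop) :
  (\forall q \near p, forall w, e w = q -> P w) -> exists w, P w.
Proof.
move=> H; have {H} : nbhs p [set q | forall w, e w = q -> P w] := H.
rewrite nbhsE => -[V [Vo Vp] VP].
have [|//|q [Vq [w _ ew]]] := @gc_embed_dense R X C V; first by exists p.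
by exists w; apply: (VP q).
Qed.

Lemma dense_le (f g : K -> R) (p : K) : {for p, continuous f} ->
  {for p, continuous g} -> (forall w, f (e w) <= g (e w)) -> f p <= g p.
Proof.
move=> cf cg fg; rewrite leNgt; apply/negP => gf.
have [|w] := @near_embed_ex p (fun w => g (e w) < f (e w)).
  have : 0 < (f \- g) p by rewrite /= subr_gt0.
  move/(cvgr_gt _ (cvgB cf cg)); apply: filterS => q /= h w ->.
  by rewrite -subr_gt0.
by rewrite ltNge fg.
Qed.

Variable x : X.

(** [exp (- (p|q)_x)] on the whole compactification: a real-valued continuous
    function, unlike the Gromov product itself, restricting to [boundary_rho]
    on the boundary. *)
Definition gromov_exp (p q : K) : R := fine (expeR (- gc_prod x p q)%E).

Lemma continuous_fine_expeRN (u : \bar R) : (0 <= u)%E ->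
  {for u, continuous (fun v : \bar R => fine (expeR (- v)%E))}.
Proof.
case: u => [r _| _|//].
- move=> P /= Pr; apply/nbhs_EFin => /=.
  have : {for r, continuous (fun s : R => expR (- s))}.
    apply: continuous_cvg; first exact: continuous_expR.
    by apply: cvgN; exact: cvg_id.
  by apply.
- apply/(@cvgrPdist_lt _ _ _ (nbhs (+oo%E : \bar R))) => eps eps0.
  exists (- ln eps); split; first exact: num_real.
  move=> [s| |]//= h; last by rewrite subrr normr0.
  rewrite sub0r normrN ger0_norm ?expR_ge0// -[ltRHS]lnK// ltr_expR.
  by rewrite ltrNl -lte_fin.
Qed.

Lemma gromov_exp_continuous : continuous (fun p : K * K => gromov_exp p.1 p.2).
Proof.
move=> p; apply: (@continuous_comp _ (\bar R) R
  (fun p : K * K => gc_prod x p.1 p.2)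
  (fun v : \bar R => fine (expeR (- v)%E))).
  exact: gc_prod_continuous.
apply: continuous_fine_expeRN; exact: gc_prod_ge0.
Qed.

Lemma gromov_exp_continuousl (q : K) : continuous (fun p : K => gromov_exp p q).
Proof.
move=> p; apply: (@continuous_comp K (K * K)%type R (fun p => (p, q))
  (fun p => gromov_exp p.1 p.2)).
  by apply: cvg_pair => //; exact: cvg_cst.
exact: gromov_exp_continuous.
Qed.

Lemma gromov_exp_continuousr (p : K) : continuous (fun q : K => gromov_exp p q).
Proof.
move=> q; apply: (@continuous_comp K (K * K)%type R (fun q => (p, q))
  (fun p => gromov_exp p.1 p.2)).
  by apply: cvg_pair => //; exact: cvg_cst.
exact: gromov_exp_continuous.
Qed.

Lemma gromov_exp_embed y z :
  gromov_exp (e y) (e z) = expR (- gromov_product x y z).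
Proof. by rewrite /gromov_exp gc_prod_embed. Qed.

Lemma gromov_exp_ge0 p q : 0 <= gromov_exp p q.
Proof. by apply: fine_ge0; exact: expeR_ge0. Qed.

(** Identities and inequalities between Gromov products extend from the space
    to its compactification, one variable at a time. *)
Lemma gromov_expC p q : gromov_exp p q = gromov_exp q p.
Proof.
suff H p' q' : gromov_exp p' q' <= gromov_exp q' p'.
  by apply/eqP; rewrite eq_le !H.
apply: (@dense_le (gromov_exp^~ q') (gromov_exp q')) => [||y].
- exact: gromov_exp_continuousl.
- exact: gromov_exp_continuousr.
apply: (@dense_le (gromov_exp (e y)) (gromov_exp^~ (e y))) => [||z].
- exact: gromov_exp_continuousr.
- exact: gromov_exp_continuousl.
by rewrite !gromov_exp_embed /gromov_product [d z y]metric_sym [d x z + _]addrC.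
Qed.

Lemma gromov_exp_eq0 (xi eta : Z) :
  gromov_exp (set_val xi) (set_val eta) = 0 <-> xi = eta.
Proof.
have Zxi := set_valP xi; have Zeta := set_valP eta.
have E := gc_prod_eqy x Zxi Zeta; rewrite /gromov_exp !set_valE.
have g0 := gc_prod_ge0 x (val xi) (val eta).
split => [|->].
- case G : gc_prod g0 => [r| |]//= _; first by move/eqP; rewrite expR_eq0.
  by move=> _; apply: val_inj; apply/E.
- by have /(_ erefl) -> := (gc_prod_eqy x Zeta Zeta).2.
Qed.

Lemma boundary_rho_separating : separating (boundary_rho C x).
Proof.
split.
- move=> p.
  apply: (@continuous_comp (Z * Z)%type (K * K)%type R
    (fun p => (set_val p.1, set_val p.2)) (fun p => gromov_exp p.1 p.2)).
    by apply: cvg_pair; apply: continuous_comp;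
      [exact: cvg_fst|exact: initial_continuous|
       exact: cvg_snd|exact: initial_continuous].
  exact: gromov_exp_continuous.
- by move=> xi eta; exact: gromov_exp_ge0.
- by move=> xi eta; exact: gromov_expC.
- by move=> xi eta; exact: gromov_exp_eq0.
Qed.

(** [(y|q)_x <= d (x, y)]; in particular the product is finite as soon as one
    of the points is not on the boundary. *)
Lemma gromov_exp_embed_ge y q : expR (- d x y) <= gromov_exp (e y) q.
Proof.
apply: (@dense_le (cst (expR (- d x y))) (gromov_exp (e y))) => [||z].
- exact: cvg_cst.
- exact: gromov_exp_continuousr.
rewrite gromov_exp_embed /gromov_product /cst ler_expR lerN2.
have := metric_triangle x y z; lra.
Qed.

Lemma gromov_exp_embed_gt0 y q : 0 < gromov_exp (e y) q.
Proof. exact: lt_le_trans (expR_gt0 _) (gromov_exp_embed_ge y q). Qed.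

(** The limit of [d (y, w) - d (x, w)] as [w] tends to [p], that is
    [d (x, y) - 2 (y|p)_x]. *)
Definition busemann (y : X) (p : K) : R := d x y + 2 * ln (gromov_exp (e y) p).

Lemma busemann_continuous y : continuous (busemann y).
Proof.
move=> p; apply: cvgD; first exact: cvg_cst.
apply: cvgM; first exact: cvg_cst.
apply: (@continuous_comp K R R (gromov_exp (e y)) (@ln R)).
  exact: gromov_exp_continuousr.
by apply: continuous_ln; exact: gromov_exp_embed_gt0.
Qed.

Lemma busemann_embed y w : busemann y (e w) = d y w - d x w.
Proof. rewrite /busemann gromov_exp_embed expRK /gromov_product; lra. Qed.

(** This is [(p|q)_z >= 0]: changing the base point from [x] to [z] adds half
    of the two Busemann functions to the Gromov product. *)
Lemma gromov_exp_le_busemann z p q :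
  gromov_exp p q <= expR ((busemann z p + busemann z q) / 2).
Proof.
have cb a : continuous (fun p' => expR ((busemann z p' + a) / 2)).
  move=> p'; apply: continuous_cvg; first exact: continuous_expR.
  apply: cvgM; last exact: cvg_cst.
  by apply: cvgD; [exact: busemann_continuous|exact: cvg_cst].
apply: (@dense_le (gromov_exp^~ q)
  (fun p => expR ((busemann z p + busemann z q) / 2))) => [||u].
- exact: gromov_exp_continuousl.
- exact: cb.
rewrite addrC; apply: (@dense_le (gromov_exp (e u)) 
  (fun q => expR ((busemann z q + busemann z (e u)) / 2))) => [||v].
- exact: gromov_exp_continuousr.
- exact: cb.
rewrite gromov_exp_embed !busemann_embed ler_expR /gromov_product.
have := metric_triangle u z v; rewrite [d u z]metric_sym; lra.
Qed.

Lemma busemann_bound y p : `|busemann y p| <= d x y.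
Proof.
apply: (@dense_le (fun p => `|busemann y p|) (cst (d x y))) => [||w].
- by apply: cvg_norm; exact: busemann_continuous.
- exact: cvg_cst.
rewrite busemann_embed /cst ler_norml.
have := metric_triangle x y w; have := metric_triangle y x w.
rewrite [d y x]metric_sym; lra.
Qed.

Hypothesis hproper : proper_metric X.

(** A closed ball is compact, so its image is closed and avoids the
    boundary. *)
Lemma boundary_far (xi : Z) (r : R) :
  \forall p \near (set_val xi : K), forall w, e w = p -> r < d x w.
Proof.
pose D := e @` [set w | d x w <= r].
have cD : closed D.
  apply: compact_closed; first exact: gc_hausdorff.
  apply: continuous_compact; last exact: hproper.
  by apply: continuous_subspaceT; exact: gc_embed_continuous.
have : nbhs (set_val xi : K) (~` D).
  apply: open_nbhs_nbhs; split; first exact: closed_openC.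
  by move=> [w _ wE]; apply: (set_valP xi); exists w.
apply: filterS => p nD w we; rewrite ltNge; apply/negP => h.
by apply: nD; exists w.
Qed.

(** A limit of points going to infinity cannot be a point [w] of the space,
    because the unit ball around [w] is the trace of a neighbourhood. *)
Lemma boundaryP (p : K) :
  (forall V, nbhs p V -> forall r : R, exists2 w, V (e w) & r < d x w) ->
  gromov_boundary C p.
Proof.
move=> H [w _ wE].
have [V Vo VE] := @gc_embed_open R X C _ (open_interior (ball w (1 : R))).
have Vp : nbhs p V.
  apply: open_nbhs_nbhs; split=> //; rewrite -wE.
  suff : (e @^-1` V) w by [].
  rewrite VE; exact: (nbhsx_ballx w 1 ltr01).
have [u Vu] := H _ Vp (d x w + 1).
have : (e @^-1` V) u by [].
rewrite VE => /interior_subset; rewrite ballEmdist/= => h1 h2.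
have := metric_triangle x w u; lra.
Qed.

(** By the two previous lemmas the boundary is closed; the cluster point found
    in the compactification is then a cluster point for the induced
    topology. *)
Lemma boundary_compact : compact [set: Z].
Proof.
have cZ : closed (gromov_boundary C : set K).
  move=> p clp; apply: boundaryP => V Vp r.
  have [xi [Zxi Vxi]] := clp _ (nbhs_interior Vp).
  pose z : Z := exist _ xi (mem_set Zxi).
  have [|w [Vw rw]] :=
    @near_embed_ex (set_val z) (fun w => V (e w) /\ r < d x w).
    have := boundary_far z r; have : nbhs (set_val z : K) V by exact: Vxi.
    by apply: filterS2 => q Vq h w we; split; [rewrite we|exact: h].
  by exists w.
have cptZ : compact (gromov_boundary C : set K).
  rewrite -[X in compact X]setTI; apply: compact_closedI => //.
  exact: gc_compact.
move=> F PF _.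
have [|p [Zp clp]] := cptZ (@set_val _ _ @ F) _.
  by apply: nearW => z; exact: set_valP.
pose z : Z := exist _ p (mem_set Zp).
exists z; split=> // A B FA [W [[W' W'o <-] W'z] WB].
have GA : (@set_val _ _ @ F) ((@set_val _ (gromov_boundary C)) @` A).
  by apply: (@filterS _ F _ A) => // a Aa; exists a.
have [q [[a Aa <-] W'q]] := clp _ _ GA (open_nbhs_nbhs (conj W'o W'z)).
by exists a; split=> //; exact: WB.
Qed.

Hypotheses (hgeod : geodesic_space X) (hcomplete : geodesically_complete X).

Lemma geodesic_extension y z (r : R) : y != z -> 0 <= r ->
  exists w, d z w = r /\ d y w = d y z + r.
Proof.
move=> yz r0; have D0 : 0 < d y z by rewrite mdist_gt0.
have [c [ci c0 cD]] := hgeod y z.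
have [l li lc] := hcomplete D0 ci.
have l0 : l 0 = y by rewrite lc// in_itv/= lexx ltW.
have lD : l (d y z) = z by rewrite lc// in_itv/= lexx ltW.
exists (l (d y z + r)); split.
- by rewrite -{1}lD li// opprD addrA subrr sub0r normrN ger0_norm.
- by rewrite -{1}l0 li// sub0r normrN ger0_norm// addr_ge0// ltW.
Qed.

(** [xi] is an accumulation point of a geodesic from [y] to [z] prolonged
    beyond [z]. *)
Lemma geodesic_endpoint y z : y != z ->
  exists xi : Z, busemann y (set_val xi) - busemann z (set_val xi) = d y z.
Proof.
move=> yz.
have /choice [w wP] n : exists w, d z w = n%:R /\ d y w = d y z + n%:R.
  exact: geodesic_extension.
have [|p [_ clp]] := @gc_compact _ _ C (e \o w @ \oo) _.
  exact: filterT.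
have Zp : gromov_boundary C p.
  apply: boundaryP => V Vp r.
  have far : \forall n \near \oo, r < d x (w n).
    near=> n; have [zw _] := wP n.
    have := metric_triangle z x (w n); rewrite zw => h.
    suff : r + d z x < n%:R by lra.
    by near: n; exact: nbhs_infty_gtr.
  have img : (e \o w @ \oo) ((e \o w) @` [set n | r < d x (w n)]).
    by apply: filterS far => n rn; exists n.
  have [q [[n rn <-] Vq]] := clp _ _ img Vp.
  by exists (w n).
exists (exist _ p (mem_set Zp)); rewrite set_valE /=.
pose D := [set q : K | busemann y q - busemann z q = d y z].
have cD : closed D.
  have cb : continuous (fun q : K => busemann y q - busemann z q).
    by move=> q; apply: cvgB; exact: busemann_continuous.
  by have := (continuous_closedP _).1 cb _ (@closed_eq _ (d y z)).
have FD : (e \o w @ \oo) D.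
  apply: (@filterS _ \oo _ setT) => [n _|]; last exact: filterT.
  have [zw yw] := wP n.
  by rewrite /D/= !busemann_embed zw yw; ring.
have : closure D p by move=> B; exact: clp.
by rewrite -(closure_id D).1.
Unshelve. all: by end_near. Qed.

(** * From potentials to extremal functions *)

Local Notation G := gromov_exp.
Variable xi0 : Z.

Lemma potential_bounded tau : potential (boundary_rho C x) tau ->
  exists M, forall xi, `|tau xi| <= M.
Proof.
move=> [ct _ _].
have := continuous_compact (continuous_subspaceT ct) boundary_compact.
move/compact_bounded => [M [_ MA]]; exists (M + 1) => xi.
by apply: (MA (M + 1)); [rewrite ltrDl|exists xi].
Qed.

Definition extremal_of (tau : Z -> R) (y : X) : R :=
  sup (range (fun xi => tau xi + busemann y (set_val xi))).

Lemma extremal_of_ge tau y xi : potential (boundary_rho C x) tau ->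
  tau xi + busemann y (set_val xi) <= extremal_of tau y.
Proof.
move=> /potential_bounded[M MP]; apply: ub_le_sup; last by exists xi.
exists (M + d x y) => _ [eta _ <-]; apply: lerD.
  exact: le_trans (ler_norm _) (MP _).
exact: le_trans (ler_norm _) (busemann_bound _ _).
Qed.

Lemma extremal_of_le tau y M :
  (forall xi, tau xi + busemann y (set_val xi) <= M) -> extremal_of tau y <= M.
Proof.
move=> h; apply: ge_sup.
  by exists (tau xi0 + busemann y (set_val xi0)), xi0.
by move=> _ [xi _ <-]; exact: h.
Qed.

(** For partners, [tau xi + tau eta = 2 (xi|eta)_x], so the right-hand side is
    [2 (xi|eta)_z]. *)
Lemma partner_busemann tau xi eta z :
  rescale (boundary_rho C x) tau xi eta = 1 ->
  0 <= (tau xi + busemann z (set_val xi)) +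
       (tau eta + busemann z (set_val eta)).
Proof.
move=> E; have := gromov_exp_le_busemann z (set_val xi) (set_val eta).
rewrite -(ler_pM2l (expR_gt0 ((tau xi + tau eta) / 2))) [leLHS]E -expRD.
rewrite -[leLHS]expR0 ler_expR; lra.
Qed.

(** If [eta] is the endpoint of the geodesic from [y] through [z] and [xi] is a
    partner of [eta], the contribution of [eta] at [y] exceeds that at [z] by
    [d (y, z)], and the contributions of [xi] and [eta] at [z] have a
    nonnegative sum. *)
Lemma extremal_of_Delta tau :
  potential (boundary_rho C x) tau -> Delta (extremal_of tau).
Proof.
move=> tauP y z; have [_ _ part] := tauP.
have [<-|yz] := eqVneq y z.
  have [eta /(partner_busemann y)] := part xi0.
  have := extremal_of_ge y xi0 tauP; have := extremal_of_ge y eta tauP.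
  rewrite mdistxx; lra.
have [eta E] := geodesic_endpoint yz.
have [xi /(partner_busemann z)] := part eta.
have := extremal_of_ge y eta tauP; have := extremal_of_ge z xi tauP; lra.
Qed.

(** Up to the term [d x w - tau xi], the supremum defining [extremal_of tau w]
    runs over [tau xi + tau eta - 2 (w|eta)].  At [w = xi] this is at most [0]
    for all [eta], and stays below [eps] nearby, uniformly in [eta] by
    compactness of the boundary; it is [0] for a partner of [xi], which gives
    the lower bound. *)
Lemma extremal_of_near tau xi (eps : R) :
  potential (boundary_rho C x) tau -> 0 < eps ->
  \forall p \near (set_val xi : K), forall w, e w = p ->
    `|extremal_of tau w - (d x w - tau xi)| <= eps.
Proof.
move=> tauP eps0; have [ct t1 te] := tauP.
pose H (p : K) (eta : Z) := expR ((tau xi + tau eta) / 2) * G p (set_val eta).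
have cH (p : K) (eta : Z) :
    {for (eta, p), continuous (fun q : Z * K => H q.2 q.1)}.
  apply: cvgM.
    apply: continuous_cvg; first exact: continuous_expR.
    apply: cvgM; last exact: cvg_cst.
    apply: cvgD; first exact: cvg_cst.
    exact: (continuous_comp (@cvg_fst _ _ _ _ _) (ct _)).
  apply: (@continuous_comp (Z * K)%type (K * K)%type R
    (fun q => (q.2, set_val q.1)) (fun p => G p.1 p.2)).
    apply: cvg_pair; first exact: cvg_snd.
    by apply: continuous_comp; [exact: cvg_fst|exact: initial_continuous].
  exact: gromov_exp_continuous.
have lnH w eta : ln (H (e w) eta) =
    (tau xi + tau eta) / 2 + ln (G (e w) (set_val eta)).
  by rewrite /H lnM ?expRK// posrE ?expR_gt0// gromov_exp_embed_gt0.
have H0 w eta : 0 < H (e w) eta.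
  by rewrite mulr_gt0 ?expR_gt0// gromov_exp_embed_gt0.
have up : \forall p \near (set_val xi : K),
    forall eta, H p eta < expR (eps / 2).
  have cover (eta : Z) : [set: Z] eta ->
      \forall eta' \near eta & p \near (set_val xi : K),
        H p eta' < expR (eps / 2).
    move=> _; have h1 : H (set_val xi) eta < expR (eps / 2).
      by apply: le_lt_trans (t1 xi eta) _; rewrite expR_gt1 divr_gt0.
    exact: (@cvgr_lt _ _ _ _ _ _ (cH (set_val xi) eta) _ h1).
  have := (compact_near_coveringP _).1 boundary_compact
    K (nbhs (set_val xi : K)) (fun p eta => H p eta < expR (eps / 2)) _ cover.
  move=> cov; near=> p => eta.
  have : [set: Z] `<=` (fun eta => H p eta < expR (eps / 2)).
    by near: p; exact: cov.
  by apply.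
have [eta0 E0] := te xi.
have low : \forall p \near (set_val xi : K), expR (- (eps / 2)) < H p eta0.
  have c0 : {for (set_val xi : K), continuous (fun p : K => H p eta0)}.
    rewrite /H; apply: cvgM; first exact: cvg_cst.
    exact: gromov_exp_continuousl.
  have h1 : expR (- (eps / 2)) < H (set_val xi) eta0.
    by rewrite [ltRHS]E0 expR_lt1 oppr_lt0 divr_gt0.
  exact: (cvgr_gt _ c0 _ h1).
apply: filterS2 up low => p up low w we; rewrite -{}we in up low.
rewrite ler_distl; apply/andP; split.
- have := extremal_of_ge w eta0 tauP.
  move: low; rewrite -[H _ _]lnK ?posrE// ltr_expR lnH /busemann; lra.
- apply: extremal_of_le => eta; have := up eta.
  by rewrite -[H _ _]lnK ?posrE// ltr_expR lnH /busemann; lra.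
Unshelve. all: by end_near. Qed.

(** If [g] lies in [Delta X] and [g <= f] with [f = extremal_of tau], then
    [g y >= d y w - g w >= d y w - f w], which tends to [busemann y xi + tau xi]
    as [w] tends to [xi]. *)
Lemma extremal_of_is_extremal tau : potential (boundary_rho C x) tau ->
  injective_hull X (extremal_of tau).
Proof.
move=> tauP; split; first exact: extremal_of_Delta.
move=> g gD gle; apply/funext => y; apply/eqP; rewrite eq_le gle /=.
apply: extremal_of_le => xi; apply/ler_addgt0Pr => eps eps0.
have e2 : 0 < eps / 2 by rewrite divr_gt0.
have nb : \forall p \near (set_val xi : K),
    busemann y (set_val xi) - eps / 2 < busemann y p.
  apply: (cvgr_gt _ (@busemann_continuous y (set_val xi))).
  by rewrite ltrBlDr ltrDl.
have [w] : exists w, busemann y (set_val xi) - eps / 2 < busemann y (e w) /\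
    `|extremal_of tau w - (d x w - tau xi)| <= eps / 2.
  apply: (@near_embed_ex (set_val xi)).
  apply: filterS2 nb (extremal_of_near xi tauP e2) => p h1 h2 w we.
  by split; [rewrite we|exact: h2].
rewrite busemann_embed ler_distl => -[h1 /andP[_ h2]].
have := gD y w; have := gle w; lra.
Qed.

Lemma potential_diff_bounded (tau tau' : Z -> R) :
  potential (boundary_rho C x) tau -> potential (boundary_rho C x) tau' ->
  exists M, forall xi, `|(tau \- tau') xi| <= M.
Proof.
move=> /potential_bounded[M MP] /potential_bounded[M' MP'].
exists (M + M') => xi.
by apply: le_trans (ler_normB _ _) _; apply: lerD.
Qed.

(** The supremum is a 1-Lipschitz function of [tau]; conversely the difference
    of the two functions tends to [tau' xi - tau xi] at [xi]. *)
Lemma extremal_of_dist (tau tau' : Z -> R) :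
  potential (boundary_rho C x) tau -> potential (boundary_rho C x) tau' ->
  hull_dist X (extremal_of tau) (extremal_of tau') = sup_norm (tau \- tau').
Proof.
move=> tP tP'.
have [N bd] := potential_diff_bounded tP tP'.
have le1 y :
    `|extremal_of tau y - extremal_of tau' y| <= sup_norm (tau \- tau').
  have le2 t t' (tP2 : potential (boundary_rho C x) t)
      (tP2' : potential (boundary_rho C x) t') (r : R) :
      (forall xi, `|t xi - t' xi| <= r) ->
      extremal_of t y <= r + extremal_of t' y.
    move=> tt; apply: extremal_of_le => // xi.
    have := extremal_of_ge y xi tP2'; have := tt xi.
    have := ler_norm (t xi - t' xi); lra.
  rewrite ler_norml lerNl opprB !lerBlDr; apply/andP; split.
    by apply: le2 => // xi; rewrite distrC; exact: (sup_norm_ge _ bd).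
  by apply: le2 => // xi; exact: (sup_norm_ge _ bd).
apply/eqP; rewrite eq_le; apply/andP; split; first exact: sup_norm_le.
apply: sup_norm_le => // xi; apply/ler_addgt0Pr => eps eps0.
have e2 : 0 < eps / 2 by rewrite divr_gt0.
have [w [h1 h2]] : exists w,
    `|extremal_of tau w - (d x w - tau xi)| <= eps / 2 /\
    `|extremal_of tau' w - (d x w - tau' xi)| <= eps / 2.
  apply: (@near_embed_ex (set_val xi)).
  have n1 := extremal_of_near xi tP e2.
  have n2 := extremal_of_near xi tP' e2.
  apply: filterS2 n1 n2.
  by move=> p g1 g2 w we; split; [exact: g1|exact: g2].
have c1 := sup_norm_ge w le1.
move: h1 h2 c1; rewrite -/(hull_dist _ _ _) !ler_distl.
move=> /andP[a1 a2] /andP[b1 b2] /andP[c3 c4].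
by rewrite /=; apply/andP; split; lra.
Qed.

(** * From extremal functions to potentials *)

Lemma unbounded_space (r : R) : exists w, r < d x w.
Proof. exact: (near_embed_ex (boundary_far xi0 r)). Qed.

(** Pushing an almost partner [z] of [y] away along a geodesic from [y] keeps it
    an almost partner, since [f] is 1-Lipschitz. *)
Lemma extremal_far_partner f y (eps r : R) : injective_hull X f -> 0 < eps ->
  exists z, r <= d x z /\ f y + f z <= d y z + eps.
Proof.
move=> fE eps0.
have [z [yz hz]] : exists z, y != z /\ f y + f z <= d y z + eps.
  have [z hz] := extremal_partner fE y eps0.
  have [yz|yz] := eqVneq y z; last by exists z.
  have [w hw] := unbounded_space (d x y); exists w.
  have yw : y != w by apply: contraTneq hw => ->; rewrite ltxx.
  split=> //; have := extremal_lipschitz fE w y; move: hz; rewrite -yz mdistxx.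
  rewrite (metric_sym w); lra.
have [|w [zw yw]] := geodesic_extension yz (r := `|r| + d x z).
  by rewrite addr_ge0 ?mdist_ge0.
exists w; split.
  have := metric_triangle z x w; rewrite (metric_sym z x) zw.
  have := ler_norm r; lra.
have := extremal_lipschitz fE w z; rewrite (metric_sym w z) zw yw; lra.
Qed.

(** That [h = d x - f] has limits at the boundary is what must be proved, so its
    limit values are first studied as a relation, the closure of its graph. *)
Section Trace.
Variable f : X -> R.
Hypothesis fE : injective_hull X f.

Let h w := d x w - f w.

Let h_bound w : `|h w| <= f x.
Proof.
have := extremal_lipschitz fE w x; have [/(_ x w) D _] := fE.
rewrite (metric_sym w) /h ler_norml => ?; apply/andP; split; lra.
Qed.

Let graph : set (K * R) := closure (range (fun w => (e w, h w))).

Let graph_exists p : exists a, graph (p, a).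
Proof.
apply: (closure_graph (@segment_compact _ (- f x) (f x))).
  by move=> w; rewrite /= in_itv /= -ler_norml.
move=> V Vp; have [w Vw] : exists w, V (e w).
  by apply: (@near_embed_ex p); apply: filterS Vp => q Vq w ->.
by exists (e w); split=> //; exists w.
Qed.

Let graph_bound p a : graph (p, a) -> `|a| <= f x.
Proof.
move=> g; apply: (closure_le (f := fun q : K * R => `|q.2|) g).
  by apply: cvg_norm; exact: cvg_snd.
by move=> _ [w _ <-]; exact: h_bound.
Qed.

Let fst_fst_cvg (q : (K * R) * (K * R)) : q'.1.1 @[q' --> q] --> q.1.1.
Proof.
exact: (@continuous_comp _ (K * R)%type K fst fst q
  (@cvg_fst _ _ _ _ _) (@cvg_fst _ _ _ _ _)).
Qed.

Let snd_fst_cvg (q : (K * R) * (K * R)) : q'.2.1 @[q' --> q] --> q.2.1.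
Proof.
exact: (@continuous_comp _ (K * R)%type K snd fst q
  (@cvg_snd _ _ _ _ _) (@cvg_fst _ _ _ _ _)).
Qed.

(** The function [exp ((a + b) / 2 - (p|q))] of the points [(p, a)] and
    [(q, b)]; on the graph of a function it is [rescale]. *)
Let rescaled (q q' : K * R) := expR ((q.2 + q'.2) / 2) * G q.1 q'.1.

Let rescaledC q q' : rescaled q q' = rescaled q' q.
Proof. by rewrite /rescaled addrC gromov_expC. Qed.

Let rescaled_continuous :
  continuous (fun q : (K * R) * (K * R) => rescaled q.1 q.2).
Proof.
move=> q; apply: cvgM.
  apply: continuous_cvg; first exact: continuous_expR.
  apply: cvgM; last exact: cvg_cst.
  by apply: cvgD; apply: continuous_comp;
    [exact: cvg_fst|exact: cvg_snd|exact: cvg_snd|exact: cvg_snd].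
apply: (@continuous_comp _ (K * K)%type R
  (fun q : (K * R) * (K * R) => (q.1.1, q.2.1)) (fun p => G p.1 p.2)).
  by apply: cvg_pair; [exact: fst_fst_cvg|exact: snd_fst_cvg].
exact: gromov_exp_continuous.
Qed.

Let rescaled_continuousl q' : continuous (rescaled^~ q').
Proof.
move=> q; apply: (@continuous_comp _ ((K * R) * (K * R))%type R
  (fun q : K * R => (q, q')) (fun q => rescaled q.1 q.2)).
  exact: (@cvg_pair _ _ _ (nbhs q) (nbhs q) (nbhs q') _ _ _ id (fun=> q')
    cvg_id (@cvg_cst _ _ _ _ _)).
exact: rescaled_continuous.
Qed.

Let rescaled_embed w z :
  rescaled (e w, h w) (e z, h z) = expR ((d w z - (f w + f z)) / 2).
Proof.
rewrite /rescaled gromov_exp_embed -expRD /h /gromov_product /=; congr expR.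
by field.
Qed.

Let graph_le1 q q' : graph q -> graph q' -> rescaled q q' <= 1.
Proof.
move=> gq gq'; apply: (closure_le gq (@rescaled_continuousl q' q)).
move=> _ [w _ <-]; rewrite rescaledC.
apply: (closure_le gq' (@rescaled_continuousl _ q')).
move=> _ [z _ <-]; rewrite rescaled_embed expR_le1.
have [/(_ z w) D _] := fE; lra.
Qed.

(** For [w] close to [xi] choose an almost partner [z w] further away than [w],
    with an error tending to [0] as [w] goes to infinity; a limit value of
    [(z w, h (z w))] is the required point. *)
Let graph_partner (xi : Z) a : graph (set_val xi, a) ->
  exists (eta : Z) b, graph (set_val eta, b) /\
    rescaled (set_val xi, a) (set_val eta, b) = 1.
Proof.
move=> gxi.
have /choice [z zP] w : exists z, d x w <= d x z /\
    f w + f z <= d w z + (1 + d x w)^-1.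
  apply: extremal_far_partner => //.
  by rewrite invr_gt0 ltr_pwDl// mdist_ge0.
pose g w := (e (z w), h (z w)).
have [|w|[eta b] cl] := @closure_graph _ _ _ (fun w => (e w, h w)) g
  ([set: K] `*` `[- f x, f x]) (set_val xi, a) _ _ gxi.
- by apply: compact_setX; [exact: gc_compact|exact: segment_compact].
- by split=> //=; rewrite in_itv /= -ler_norml.
pose lim : (K * R) * (K * R) := ((set_val xi, a), (eta, b)).
have c1 : q.1.1 @[q --> lim] --> (set_val xi : K) by exact: fst_fst_cvg.
have c2 : q.2.1 @[q --> lim] --> eta by exact: snd_fst_cvg.
have far (r : R) : \forall q \near lim, forall w, e w = q.1.1 -> r < d x w.
  exact: (c1 [set p | forall w, e w = p -> r < d x w]
    (boundary_far xi r)).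
have Zeta : gromov_boundary C eta.
  apply: boundaryP => V Veta r.
  have [_ [[w _ <-] [rw Vw]]] := cl _ (filterI (far r) (c2 _ Veta)).
  by exists (z w) => //; apply: lt_le_trans (zP w).1; exact: rw.
have geta : graph (eta, b).
  move=> V Vb.
  have nV : \forall q \near lim, V q.2 by exact: (@cvg_snd _ _ _ _ _ _ Vb).
  have [_ [[w _ <-] Vw]] := cl _ nV.
  by exists (g w); split=> //; exists (z w).
exists (exist _ eta (mem_set Zeta)), b; rewrite !set_valE/=; split=> //.
apply/eqP; rewrite eq_le graph_le1//=.
apply/ler_addgt0Pr => eps eps0; rewrite leNgt; apply/negP => lt1.
have {}lt1 : rescaled lim.1 lim.2 < 1 - eps by rewrite ltrBrDr.
have nr : \forall q \near lim, rescaled q.1 q.2 < 1 - eps.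
  exact: (cvgr_lt _ (@rescaled_continuous lim) _ lt1).
have [_ [[w _ <-] [/= wf]]] := cl _ (filterI (far eps^-1) nr).
rewrite rescaled_embed; apply/negP; rewrite -leNgt.
apply: le_trans (expR_ge1Dx _); rewrite lerD2l.
have i0 : (1 + d x w)^-1 <= eps.
  rewrite -[leRHS]invrK lef_pV2 ?posrE ?invr_gt0 ?ltr_pwDl ?mdist_ge0//.
  have := wf w erefl; lra.
have := (zP w).2; lra.
Qed.

(** If [(eta, c)] is the partner of [(xi, a)], then [a + c = 2 (xi|eta)], while
    [b + c <= 2 (xi|eta)]. *)
Let graph_unique (xi : Z) a b :
  graph (set_val xi, a) -> graph (set_val xi, b) -> a = b.
Proof.
suff le a' b' : graph (set_val xi, a') -> graph (set_val xi, b') -> b' <= a'.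
  by move=> ga gb; apply/eqP; rewrite eq_le !le.
move=> ga gb; have [eta [c [gc E]]] := graph_partner ga.
have G0 : 0 < G (set_val xi) (set_val eta).
  rewrite lt_neqAle gromov_exp_ge0 andbT; apply: contra_eqN E => /eqP.
  by rewrite /rescaled /= => <-; rewrite mulr0 eq_sym oner_eq0.
have := graph_le1 gb gc; rewrite -E /rescaled /= ler_pM2r// ler_expR; lra.
Qed.

(** Above the boundary the closed bounded relation [graph] is a function [tau],
    hence a continuous one.  Then [extremal_of tau <= f] by passing to the limit
    in [d y w - f w <= f y], and the minimality of [f] concludes. *)
Lemma extremal_has_potential :
  exists2 tau, potential (boundary_rho C x) tau & extremal_of tau = f.
Proof.
have /choice [tau tauP] (xi : Z) := graph_exists (set_val xi).
have part xi : exists eta, rescale (boundary_rho C x) tau xi eta = 1.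
  have [eta [b [gb E]]] := graph_partner (tauP xi).
  by exists eta; rewrite /rescale (graph_unique (tauP eta) gb).
have tauC : continuous tau.
  move=> xi; apply/(@cvgrPdist_lt _ _ _ (nbhs xi)) => eps eps0.
  (* Values of [tau] far from [tau xi] lie in a compact set [A] over which the
     closed set [graph] has no point above [xi], hence none nearby. *)
  pose A := `[- f x, f x] `&` [set a | eps <= `|tau xi - a|].
  have cA : compact A.
    apply: compact_closedI; first exact: segment_compact.
    have cn : continuous (fun a : R => `|tau xi - a|).
      by move=> a; apply: cvg_norm; apply: cvgB; [exact: cvg_cst|exact: cvg_id].
    exact: ((continuous_closedP _).1 cn _ (@closed_ge _ eps)).
  have cover a : A a ->
      \forall a' \near a & p \near (set_val xi : K), ~ graph (p, a').
    move=> [_ /= ea].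
    have : nbhs (set_val xi : K, a) (~` graph).
      apply: open_nbhs_nbhs; split; first exact/closed_openC/closed_closure.
      move=> /(graph_unique (tauP xi)) E; move: ea.
      by rewrite E subrr normr0 leNgt eps0.
    move=> [[P Q] /= [Pp Qa] PQ]; exists (Q, P) => // -[a' p] [/= Qa' Pp'].
    exact: (PQ (p, a')).
  pose N := [set p : K | A `<=` (fun a => ~ graph (p, a))].
  have nearN : nbhs (set_val xi : K) N.
    exact: ((compact_near_coveringP _).1 cA K (nbhs (set_val xi : K))
      (fun p a => ~ graph (p, a)) _ cover).
  have svC : {for xi, continuous (@set_val _ (gromov_boundary C))}.
    exact: initial_continuous.
  near=> xi'; have nA : N (set_val xi') by near: xi'; exact: svC nearN.
  rewrite ltNge; apply/negP => h1.
  apply: (nA (tau xi')) (tauP xi'); split=> //=.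
  by rewrite in_itv /= -ler_norml; exact: graph_bound (tauP xi').
have tP : potential (boundary_rho C x) tau.
  by split=> // xi eta; exact: (graph_le1 (tauP xi) (tauP eta)).
exists tau => //; have [_ fmin] := fE.
apply: fmin; first exact: extremal_of_Delta.
move=> y; apply: extremal_of_le => // xi.
apply: (closure_le (f := fun q : K * R => q.2 + busemann y q.1) (tauP xi)).
  apply: cvgD; first exact: cvg_snd.
  exact: (continuous_comp (@cvg_fst _ _ _ _ _) (@busemann_continuous y _)).
move=> _ [w _ <-] /=; rewrite busemann_embed /h.
have [/(_ y w) D _] := fE; lra.
Unshelve. all: by end_near. Qed.

End Trace.

Lemma potential_isometric_hull :
  isometric_sets (potential (boundary_rho C x))
    (fun tau tau' => sup_norm (tau \- tau')) (injective_hull X) (hull_dist X).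
Proof.
exists extremal_of; last by move=> tau tau'; exact: extremal_of_dist.
split.
- by move=> tau tP; exact: extremal_of_is_extremal.
- move=> tau tau' /set_mem tP /set_mem tP' E.
  have [N bd] := potential_diff_bounded tP tP'.
  have D0 : sup_norm (tau \- tau') <= 0.
    rewrite -(extremal_of_dist tP tP') E; apply: sup_norm_le => // y.
    by rewrite subrr normr0.
  apply/funext => xi; apply/eqP; rewrite -subr_eq0 -normr_le0.
  exact: le_trans (sup_norm_ge xi bd) D0.
- by move=> f /extremal_has_potential[tau tP <-]; exists tau.
Qed.

End Compactification.

(** * The injective hull and the Moebius space *)

Lemma four_points_three (T : choiceType) : `I_4 #<= [set: T] ->
  forall a : T, exists b c, uniq [:: a; b; c].
Proof.
move=> /card_leP[g] a.
pose f i (i4 : (i < 4)%N) : T := val (g (exist _ i (mem_set i4))).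
have nf i j i4 j4 : i != j -> @f i i4 != @f j j4.
  apply: contra_neq => /val_inj/(@inj _ _ _ g) E.
  by have /= := congr1 val (E (mem_set I) (mem_set I)).
pose c0 := @f 0 isT; pose c1 := @f 1 isT; pose c2 := @f 2 isT.
have n01 : c0 != c1 by exact: nf.
have n02 : c0 != c2 by exact: nf.
have n12 : c1 != c2 by exact: nf.
have [->|a0] := eqVneq a c0.
  by exists c1, c2; rewrite /= !inE !negb_or n01 n02 n12.
have [->|a1] := eqVneq a c1.
  by exists c0, c2; rewrite /= !inE !negb_or eq_sym n01 n02 n12.
by exists c0, c1; rewrite /= !inE !negb_or a0 a1 n01.
Qed.

Theorem theorem1p9 (R : realType) (X : metricType R)
    (hX : gromov_product_space X)
    (C : gromov_compactification X)
    (h4 : `I_4 #<= [set: gromov_boundary C])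
    (x : X) :
  isometric_sets (injective_hull X) (hull_dist X)
    (moebius_space (boundary_rho C x)) (moebius_dist (gromov_boundary C)).
Proof.
have [hproper hgeod hcomplete _] := hX.
have three := four_points_three h4.
have [f] := card_leP h4.
pose xi0 : gromov_boundary C := val (f (exist _ 0 (mem_set (isT : (0 < 4)%N)))).
apply: isometric_sets_trans
  (potential_isometric_moebius three (boundary_rho_separating C x) xi0).
apply: isometric_sets_sym.
- exact: (cst 0).
- exact: (cst 0).
- exact: potential_isometric_hull.
Qed.
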